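(* Let $m \geq 1$ be an integer and let $a_m = \nu_2(m(m+1))$. Then \[ m \equiv C(m) \equiv C^2(m) \equiv \cdots \equiv C^{a_m - 1}(m) \not\equiv C^{a_m}(m) \pmod 2, \] i.e. $a_m$ is the first time at which the orbit $m, C(m), C^2(m), \dots$ changes parity.
   Context: $\nu_2$ denotes the $2$-adic valuation. The Collatz map $C:\mathbb{N}\to\mathbb{N}$ is $C(i) = i/2$ if $i$ is even and $C(i) = (3i+1)/2$ if $i$ is odd; $C^k$ denotes its $k$-fold iterate. (In the paper, $a_m$ is also identified with $\nu_2(A_{1,m}) - 1$ for a certain integer sequence $A_{1,m}$.) *)

(* Defs.v *)
From mathcomp Require Import all_boot.

Set Implicit Arguments.
Unset Strict Implicit.
Unset Printing Implicit Defensive.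

(* Both quotients are exact. *)
Definition collatz (i : nat) : nat :=
  if odd i then (3 * i + 1) %/ 2 else i %/ 2.

(* Main.v *)
(** Iterating [C] is explicit as long as only powers of 2 are consumed:
    [C^k(2^k q) = q], and [C^k(2^k q - 1) = 3^k q - 1].  An even [m] is of the
    first form and an odd [m] of the second exactly for [k] up to the 2-adic
    valuation of [m], resp. of [m + 1], which is [a] because the other factor
    is odd; in both cases the parity of [q] decides that of [C^k(m)], and [q]
    becomes odd precisely at [k = a]. *)

Require Import Defs.
From mathcomp Require Import all_boot zify.

Implicit Types k m n p q : nat.

Lemma dvdn_div_pfactor p n k : prime p -> 0 < n -> k <= logn p n ->
  (p %| n %/ p ^ k) = (k < logn p n).
Proof.
move=> p_pr n_gt0 k_le.
by rewrite dvdn_divRL ?pfactor_dvdn // -expnS pfactor_dvdn.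
Qed.

Lemma odd_div_exp2 n k : 0 < n -> k <= logn 2 n ->
  odd (n %/ 2 ^ k) = (k == logn 2 n).
Proof.
move=> n_gt0 k_le; apply: negb_inj.
by rewrite -dvdn2 dvdn_div_pfactor // ltn_neqAle k_le andbT.
Qed.

Lemma odd_predn n : 0 < n -> odd n.-1 = ~~ odd n.
Proof. by case: n => //= n _; rewrite negbK. Qed.

Lemma logn2_mulnS n : logn 2 (n * n.+1) = logn 2 (if odd n then n.+1 else n).
Proof.
case: ifPn => [odd_n | even_n]; first by rewrite logn_Gauss ?coprime2n.
by rewrite mulnC logn_Gauss ?coprime2n.
Qed.

Lemma logn2_mulnS_gt0 n : 0 < n -> 0 < logn 2 (n * n.+1).
Proof.
move=> n_gt0; rewrite -pfactor_dvdn ?muln_gt0 ?n_gt0 //.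
by rewrite dvdn2 oddM oddS andbN.
Qed.

Lemma collatz_double n : collatz n.*2 = n.
Proof. by rewrite /collatz odd_double divn2 doubleK. Qed.

(* At [n = 0] both predecessors are truncated to the fixed point 0. *)
Lemma collatz_double_predn n : collatz n.*2.-1 = (3 * n).-1.
Proof. by case: n => // n; rewrite /collatz doubleS /= odd_double /=; lia. Qed.

Lemma iter_collatz_exp2 k q : iter k collatz (2 ^ k * q) = q.
Proof.
elim: k => [|k IHk]; first exact: mul1n.
by rewrite iterSr expnS -mulnA mul2n collatz_double.
Qed.

Lemma iter_collatz_exp2_predn k q :
  iter k collatz (2 ^ k * q).-1 = (3 ^ k * q).-1.
Proof.
elim: k q => [|k IHk] q //.
rewrite iterSr expnS -mulnA mul2n collatz_double_predn mulnCA IHk.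
by rewrite mulnA -expnSr.
Qed.

Lemma odd_iter_collatz m k (a := logn 2 (m * m.+1)) : 0 < m -> k <= a ->
  odd (iter k collatz m) = odd m (+) (k == a).
Proof.
rewrite {}/a logn2_mulnS => m_gt0; case: ifP => odd_m k_le.
  have dvd_mS : 2 ^ k %| m.+1 by rewrite pfactor_dvdn.
  have {1}-> : m = (2 ^ k * (m.+1 %/ 2 ^ k)).-1 by rewrite mulnC divnK.
  have q_gt0 : 0 < m.+1 %/ 2 ^ k by rewrite divn_gt0 ?expn_gt0 // dvdn_leq.
  rewrite iter_collatz_exp2_predn odd_predn ?muln_gt0 ?expn_gt0 //.
  by rewrite oddM oddX orbT odd_div_exp2.
have dvd_m : 2 ^ k %| m by rewrite pfactor_dvdn.
have {1}-> : m = 2 ^ k * (m %/ 2 ^ k) by rewrite mulnC divnK.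
by rewrite iter_collatz_exp2 odd_div_exp2.
Qed.

Theorem theorem6p1 (m : nat) (hm : 1 <= m) :
  let a := logn 2 (m * (m + 1)) in
  (forall k : nat, k + 1 <= a - 1 ->
     iter k collatz m = iter (k + 1) collatz m %[mod 2]) /\
  iter (a - 1) collatz m <> iter a collatz m %[mod 2].
Proof.
rewrite addn1; have a_gt0 := logn2_mulnS_gt0 m hm.
have oddE k := odd_iter_collatz m k hm.
set a := logn 2 _ in a_gt0 oddE * => /=.
have parity_lt k : k < a -> odd (iter k collatz m) = odd m.
  by move=> k_lt; rewrite oddE ?(ltnW k_lt) // (ltn_eqF k_lt) addbF.
split=> [k k_lt|]; first by rewrite !modn2 !parity_lt //; lia.
rewrite !modn2 parity_lt ?oddE ?eqxx //; last by lia.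
by case: (odd m).
Qed.
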